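(* Let $\Omega\subset\mathbf{R}^2$ be a smooth, bounded, convex open set. Assume that $m=d=3$. Then there exists $\mu\in\mathcal{A}_d$ such that every $\Lambda(\mu)$-minimizer is connected.
   Context: $\mathbf{N}=\{0,1,2,\dots\}$. $\mathcal{A}_d$ is the set of measures $\mu=2\pi\sum_{k=1}^{md}\delta_{x_k}$ with $x_1,\dots,x_{md}$ distinct points of $\Omega$ (here $md=9$). A compact set $\Gamma$ is a $\Lambda(\mu)$-minimizer if it minimizes $\mathcal{H}^1(\Gamma)$ among compact sets $\Gamma$ with $\mathrm{spt}\,\mu\subset\Gamma$ such that every connected component $\Sigma$ of $\Gamma$ satisfies $\mathrm{Card}(\Sigma\cap\mathrm{spt}\,\mu)\in m\mathbf{N}$. Since components containing no point of $\mathrm{spt}\,\mu$ can be removed, the minimization is reduced to sets $\Gamma$ whose connected components all contain a positive number of points of $\mathrm{spt}\,\mu$. *)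

(* Defs.v *)
(* MathComp-Analysis: the plane is R * R for an arbitrary R : realType. *)
From HB Require Import structures.
From mathcomp Require Import all_boot all_order all_algebra.
From mathcomp Require Import all_classical all_reals all_analysis.

Set Implicit Arguments.
Unset Strict Implicit.
Unset Printing Implicit Defensive.

Import Order.TTheory GRing.Theory Num.Theory.
Import numFieldNormedType.Exports.

Local Open Scope classical_set_scope.
Local Open Scope ring_scope.

Section Hausdorff.
Context {R : realType}.

(* The library norm on R * R is the sup norm, which would give the wrong
   notion of length. *)
Definition euclid_dist (x y : R * R) : R :=
  Num.sqrt ((x.1 - y.1) ^+ 2 + (x.2 - y.2) ^+ 2).

(* 0 is inserted so that the empty set has diameter 0 rather than -oo. *)
Definition diameter (A : set (R * R)) : \bar R :=
  ereal_sup (0%E |` [set (euclid_dist x y)%:E | x in A & y in A]).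

Definition hausdorff1_pre (delta : R) (A : set (R * R)) : \bar R :=
  ereal_inf [set (\sum_(0 <= i <oo) diameter (F i))%E |
             F in [set F : nat -> set (R * R) |
                   (forall i, (diameter (F i) <= delta%:E)%E) /\
                   A `<=` \bigcup_i F i]].

(* The limit as delta tends to 0 is a supremum, hausdorff1_pre being
   nonincreasing in delta. The normalizing constant is 1 in dimension one. *)
Definition hausdorff1 (A : set (R * R)) : \bar R :=
  ereal_sup [set hausdorff1_pre delta A | delta in [set delta : R | 0 < delta]].

End Hausdorff.

Section SmoothBoundary.
Context {R : realType}.

Definition smooth_fun (g : R -> R) : Prop :=
  forall (n : nat) (t : R), derivable (derive1n n g) t 1.

(* Near each boundary point p, Omega is the open epigraph of a C^oo function
   in the orthonormal frame ((c, s), (- s, c)) centred at p. *)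
Definition smooth_boundary (Omega : set (R * R)) : Prop :=
  forall p : R * R, (closure Omega `\` interior Omega) p ->
  exists c s : R, exists g : R -> R,
    [/\ c ^+ 2 + s ^+ 2 = 1, smooth_fun g &
        \forall x \near p,
          Omega x <->
          g (c * (x.1 - p.1) + s * (x.2 - p.2)) <
            - s * (x.1 - p.1) + c * (x.2 - p.2)].

End SmoothBoundary.

Section Vortices.
Context {R : realType}.

(* The set A_d of measures 2 pi \sum_(k < m d) \d_(x k). *)
Definition vortex_measures (m d : nat) (Omega : set (R * R)) :
    set {measure set (R * R) -> \bar R} :=
  [set mu | exists x : 'I_(m * d) -> R * R,
    [/\ injective x, forall k, Omega (x k) &
        forall A : set (R * R), measurable A ->
          mu A = ((2 * pi)%:E * \sum_(k < m * d) \d_(x k) A)%E]].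

Definition spt (mu : {measure set (R * R) -> \bar R}) : set (R * R) :=
  [set x | forall U : set (R * R), open U -> U x -> (0 < mu U)%E].

(* The number of vortices in a component is a positive multiple of m. If 0 were
   allowed, adding an isolated point to a minimizer would keep its length and
   disconnect it. *)
Definition admissible (m : nat) (mu : {measure set (R * R) -> \bar R})
    (Gamma : set (R * R)) : Prop :=
  [/\ compact Gamma, spt mu `<=` Gamma &
      forall x, Gamma x -> exists2 k : nat, (0 < k)%N &
        ((connected_component Gamma x `&` spt mu) #= `I_(m * k))%card].

Definition Lambda_minimizer (m : nat) (mu : {measure set (R * R) -> \bar R})
    (Gamma : set (R * R)) : Prop :=
  admissible m mu Gamma /\
  forall Gamma' : set (R * R), admissible m mu Gamma' ->
    (hausdorff1 Gamma <= hausdorff1 Gamma')%E.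

End Vortices.

(* Main.v *)
Require Import Defs.
From HB Require Import structures.
From mathcomp Require Import all_boot all_order all_algebra.
From mathcomp Require Import all_classical all_reals all_analysis.
From mathcomp Require Import ring lra zify.
Set Implicit Arguments.
Unset Strict Implicit.
Unset Printing Implicit Defensive.
Import Order.TTheory GRing.Theory Num.Theory.
Import numFieldNormedType.Exports.
Local Open Scope classical_set_scope.
Local Open Scope ring_scope.

(** Up to a translation and a scaling, the nine points are the origin and
    four close pairs of points.  The pairs sit at the tips (4, 1), (4, -1),
    (-4, 1) and (-4, -1) of a tree shaped like an H with bent arms: a trunk
    from (-13/4, 0) to (13/4, 0), and four limbs of length 5/4 from its ends
    to the tips.  The second point of each pair lies on the limb, at one
    hundredth of its length, and the origin lies on the trunk.  So this
    connected tree, of length 13/2 + 4 * 5/4 = 23/2, carries all the points.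

    Cutting any edge of the tree leaves a number of points that is not a
    multiple of 3 on each side, so a disconnected competitor has to run through
    some region twice.  Let K be the component of the origin and M another
    component.  Two cases arise.
    - M meets both sides x < 0 and x > 0.  Then M has length almost 8, and K,
      which contains a point besides the origin, has length almost 4.
    - Every component other than K stays on one side.  It then consists of 3 of
      the 4 points of that side, hence joins an upper and a lower point, at the
      cost of almost 2; the fourth point of that side is left to K.  On the
      opposite side, either another such component costs almost 2 more while K
      still has length almost 8, or K contains both outer tips and has length
      at least 8 + 17/10, up to a small error.
    In all cases the length exceeds 58/5 > 23/2, so that a minimizer is
    connected.  The limbs form a 3-4-5 triangle with the trunk: a fork adds
    2 * 5/4 - 3/4 = 7/4 to the length, strictly less than the height 2 that a
    local component pays.

    The lower bounds on length all come from [hausdorff1_ge_tripods]: if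
    disjoint compact connected sets contain three points a, b, c each, and
    u1, u2, u3 are vectors of norm at most 1 with sum 0, then the total length
    is at least the sum of the numbers <u1, a> + <u2, b> + <u3, c>.  This is the
    calibration of a Steiner tripod.  It is proved without rectifiable
    arcs, on the coverings that define the Hausdorff measure: a fine covering by
    small sets can be made finite and open, its nerve along a connected set is a
    connected graph, and a tripod is drawn in that graph ([tripod_bound]). *)

(** * Tripods in the nerve of a covering *)

Section Nerve.
Context {R : realType}.
Implicit Types (u x y : R * R).

Definition dot u x : R := u.1 * x.1 + u.2 * x.2.

Definition short u : Prop := u.1 ^+ 2 + u.2 ^+ 2 <= 1.

Lemma short_opp u : short u -> short (- u).
Proof. by rewrite /short /= !sqrrN. Qed.

Lemma dotNl u x : dot (- u) x = - dot u x.
Proof. by rewrite /dot /=; ring. Qed.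

Lemma dot_le_dist u x y : short u -> dot u x - dot u y <= euclid_dist x y.
Proof.
rewrite /short /dot /euclid_dist => u1.
apply: (le_trans (ler_norm _)); rewrite -sqrtr_sqr; apply: ler_wsqrtr.
move: u1; case: u x y => [a b] [x1 x2] [y1 y2] /= u1.
set p := x1 - y1; set q := x2 - y2.
have -> : a * x1 + b * x2 - (a * y1 + b * y2) = a * p + b * q.
  by rewrite /p /q; ring.
have h : (a * p + b * q) ^+ 2 + (a * q - b * p) ^+ 2 =
         (a ^+ 2 + b ^+ 2) * (p ^+ 2 + q ^+ 2) by ring.
have h2 : (a ^+ 2 + b ^+ 2) * (p ^+ 2 + q ^+ 2) <= p ^+ 2 + q ^+ 2.
  by rewrite ler_piMl // addr_ge0 // sqr_ge0.
by have := sqr_ge0 (a * q - b * p); lra.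
Qed.

Context {T : finType} (U : T -> set (R * R)) (w : T -> R).
Hypothesis U_open : forall i, open (U i).
Hypothesis w_ge0 : forall i, 0 <= w i.
Hypothesis U_width : forall i u x y, short u -> U i x -> U i y ->
  dot u x - dot u y <= w i.

Context (K : set (R * R)).
Hypothesis K_conn : connected K.
Hypothesis K_cover : K `<=` \bigcup_i U i.

(** The members of the covering that are charged to K. *)
Definition touching : {set T} := [set i | `[< U i `&` K !=set0 >]].

Lemma touchingP i : reflect (exists2 x, U i x & K x) (i \in touching).
Proof.
rewrite finset.in_set; apply: (iffP (asboolP _)) => [[x []]|[x]]; first by exists x.
by exists x.
Qed.

Definition nerve : rel T := fun i j => `[< U i `&` U j `&` K !=set0 >].

Lemma nerve_touching i j : nerve i j -> (i \in touching) && (j \in touching).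
Proof.
move=> /asboolP[x [[ix jx] Kx]].
by apply/andP; split; apply/touchingP; exists x.
Qed.

(** The members reachable from i and those that are not cut K into two relatively
    open pieces, disjoint because two members sharing a point of K are adjacent. *)
Lemma nerve_connect i j : i \in touching -> j \in touching -> connect nerve i j.
Proof.
move=> /touchingP[x ix Kx] /touchingP[y jy Ky].
pose V := \bigcup_(k in [set k | connect nerve i k]) U k.
pose W := \bigcup_(k in [set k | ~~ connect nerve i k]) U k.
have VW z : K z -> V z -> W z -> False.
  move=> Kz [k /= ik kz] [l /= il lz]; move/negP: il; apply.
  by apply: (connect_trans ik); apply: connect1; apply/asboolP; exists z.
have VK : K `&` V = K.
  apply: K_conn.
  - by exists x; split => //; exists i => //=; exact: connect0.
  - by exists V => //; apply: bigcup_open => k _; exact: U_open.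
  - exists (~` W); first by apply: open_closedC; apply: bigcup_open => k _; exact: U_open.
    apply/seteqP; split=> z [Kz h]; split=> //; first exact: VW.
    have [k _ kz] := K_cover Kz.
    case ik : (connect nerve i k); first by exists k.
    by exfalso; apply: h; exists k => //=; rewrite ik.
have : (K `&` V) y by rewrite VK.
move=> [_ [k /= ik ky]]; apply: (connect_trans ik); apply: connect1.
by apply/asboolP; exists y.
Qed.

(** A chain of overlapping sets cannot move a 1-Lipschitz function further than
    the sum of its widths. *)
Lemma chain_width i p u x y : path nerve i p -> short u -> U i x ->
  U (last i p) y -> dot u x - dot u y <= \sum_(k <- i :: p) w k.
Proof.
move=> + us; elim: p i x => [|j p IH] i x /=.
  by move=> _ ix iy; rewrite big_seq1; exact: U_width.
move=> /andP[/asboolP[z [[iz jz] _]] pth] ix ly.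
have := IH _ _ pth jz ly; have := U_width us ix iz.
by rewrite big_cons; lra.
Qed.

Lemma sum_touching (s : seq T) : uniq s -> all (mem touching) s ->
  \sum_(k <- s) w k <= \sum_(k in touching) w k.
Proof.
move=> us /allP sT; rewrite big_uniq //=.
rewrite [leRHS](bigID (mem s)) /= [X in _ <= X + _](eq_bigl (mem s)).
  by rewrite lerDl sumr_ge0.
by move=> k /=; rewrite andb_idl //; exact: sT.
Qed.

Lemma path_touching i p : path nerve i p -> i \in touching ->
  all (mem touching) (i :: p).
Proof.
elim: p i => [|j p IH] i /=; first by move=> _ ->.
by move=> /andP[/nerve_touching/andP[ii jj] pth] _; rewrite ii; exact: IH.
Qed.

(** A simple chain joins a to b, and a chain from c is followed until it first
    hits the former, at some member j.  The three branches issued from j have no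
    member in common except j, whose width is counted three times: this is the
    error 2 * dl.  A common end z of the branches disappears from the sum
    because u1 + u2 + u3 = 0. *)
Lemma tripod_bound (dl : R) a b c u1 u2 u3 :
  (forall i, w i <= dl) -> K a -> K b -> K c ->
  short u1 -> short u2 -> short u3 -> u1 + u2 + u3 = 0 ->
  dot u1 a + dot u2 b + dot u3 c <= \sum_(k in touching) w k + 2 * dl.
Proof.
move=> wdl Ka Kb Kc s1 s2 s3 u0.
have [ia _ Ua] := K_cover Ka.
have [ib _ Ub] := K_cover Kb.
have [ic _ Uc] := K_cover Kc.
have ta : ia \in touching by apply/touchingP; exists a.
have tb : ib \in touching by apply/touchingP; exists b.
have tc : ic \in touching by apply/touchingP; exists c.
have /connectP[p0 /shortenP[p pthp unip _] ibE] := nerve_connect ta tb.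
have /connectP[q0 /shortenP[q pthq uniq_q _] iaE] := nerve_connect tc ta.
have hP : has (mem (ia :: p)) (ic :: q).
  by apply/hasP; exists ia; [rewrite {1}iaE mem_last | exact: mem_head].
have tq := path_touching pthq tc; have tp := path_touching pthp ta.
(* j is the first member of the chain from c that belongs to the chain a -- b. *)
have [q1 [j [q2 [qE jP q1P]]]] : exists q1 j q2,
    [/\ ic :: q = q1 ++ j :: q2, j \in ia :: p & ~~ has (mem (ia :: p)) q1].
  move: hP; elim: (ic :: q) => [|k s IH] //=.
  case kP : (k \in ia :: p) => /=; first by exists [::], k, s.
  move=> /IH[q1 [j [q2 [-> jP q1P]]]]; exists (k :: q1), j, q2.
  by split=> //=; rewrite kP.
have [p1 [p2 pE]] : exists p1 p2, ia :: p = p1 ++ j :: p2.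
  by case/splitPr: jP => p1 p2; exists p1, p2.
have [z jz Kz] : exists2 z, U j z & K z.
  by apply/touchingP; move/allP: tp; exact.
have chain k s k' s' x y u : k :: s = k' ++ j :: s' -> path nerve k s -> short u ->
    U k x -> U j y -> dot u x - dot u y <= \sum_(l <- rcons k' j) w l.
  case: k' => [[<- _] _|_ k' [<- ->] pth] us kx jy.
    by rewrite big_seq1; exact: U_width.
  move: pth; rewrite -cat_rcons cat_path => /andP[pth _].
  rewrite rcons_cons; apply: (chain_width pth us kx).
  by rewrite last_rcons.
have chainb u : short u -> dot u b - dot u z <= \sum_(l <- j :: p2) w l.
  move=> /short_opp us; suff: dot (- u) z - dot (- u) b <= \sum_(l <- j :: p2) w l.
    by rewrite !dotNl; lra.
  move: pthp pE ibE; case: (p1) => [|k p1'] /= pthp [iaj pE] ibE.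
    by apply: (chain_width _ us jz); rewrite -iaj -pE // -ibE.
  move: pthp ibE; rewrite pE cat_path last_cat /= => /and3P[_ _ pth2] ibE.
  by apply: (chain_width pth2 us jz); rewrite -ibE.
have Ha := chain _ _ _ _ _ _ _ pE pthp s1 Ua jz.
have Hc := chain _ _ _ _ _ _ _ qE pthq s3 Uc jz.
have Hb := chainb _ s2.
have uz : dot u1 z + dot u2 z + dot u3 z = 0.
  move: (congr1 fst u0) (congr1 snd u0); rewrite /dot /= => e1 e2.
  transitivity ((u1.1 + u2.1 + u3.1) * z.1 + (u1.2 + u2.2 + u3.2) * z.2).
    by ring.
  by rewrite e1 e2 !mul0r addr0.
have := @sum_touching (q1 ++ p1 ++ j :: p2).
rewrite -pE cat_uniq has_sym unip q1P andbT all_cat tp andbT.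
move: uniq_q tq; rewrite qE cat_uniq all_cat => /andP[-> _] /andP[-> _].
move=> /(_ isT isT); rewrite pE !big_cat /= => tot.
have := wdl j; move: Ha Hb Hc tot.
by rewrite -!cats1 !big_cat /= !big_seq1 !big_cons; lra.
Qed.
End Nerve.

(** * From Hausdorff coverings to finite open coverings *)

Section LowerBound.
Context {R : realType}.
Implicit Types (u x y : R * R) (A B K : set (R * R)).

Lemma diameter_ge0 A : (0 <= diameter A)%E.
Proof. by apply: ereal_sup_ubound; left. Qed.

Lemma dist_le_diameter A x y : A x -> A y ->
  ((euclid_dist x y)%:E <= diameter A)%E.
Proof. by move=> Ax Ay; apply: ereal_sup_ubound; right; exists x => //; exists y. Qed.

Lemma compact_separated A B : compact A -> compact B -> A `&` B = set0 ->
  exists2 r : R, 0 < r &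
    forall x y, A x -> B y -> r <= Num.max `|x.1 - y.1| `|x.2 - y.2|.
Proof.
move=> cA cB AB0.
have [[z [zA zB]]|AxB0] := pselect ((A `*` B) !=set0); last first.
  by exists 1 => // x y Ax By; exfalso; apply: AxB0; exists (x, y).
pose f (z : (R * R) * (R * R)) : R := `|z.1 - z.2|.
have cf : continuous f.
  move=> t; apply: cvg_norm; apply: cvgB; [exact: cvg_fst | exact: cvg_snd].
have [|c cAB cmin] := compact_EVT_min _ (compact_setX cA cB) (continuous_subspaceT cf).
  by exists z.
exists (f c).
  rewrite /f normr_gt0 subr_eq0; apply/eqP => c12.
  move: cAB; rewrite inE => -[c1 c2].
  suff : (A `&` B) c.1 by rewrite AB0.
  by split=> //; rewrite c12.
by move=> x y Ax By; have := cmin (x, y); rewrite /f prod_normE /= inE; apply.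
Qed.

Lemma short_coord u : short u -> `|u.1| <= 1 /\ `|u.2| <= 1.
Proof.
rewrite /short => u1.
have h (t : R) : t ^+ 2 <= 1 -> `|t| <= 1.
  by rewrite ler_norml => ?; apply/andP; split; nra.
by split; apply: h; move: u1 (sqr_ge0 u.1) (sqr_ge0 u.2); lra.
Qed.

(** Widths are measured by vectors of norm at most 1 rather than by diameters:
    nothing more is needed to follow a chain of sets. *)
Lemma thicken A (d e : R) : 0 < e -> (diameter A <= d%:E)%E ->
  exists U, [/\ open U, A `<=` U &
    forall u x y, short u -> U x -> U y -> dot u x - dot u y <= d + e].
Proof.
move=> e0 Ad; exists (\bigcup_(a in A) ball a (e / 4)); split.
- by apply: bigcup_open => a _; apply: ball_open; rewrite divr_gt0.
- by move=> a Aa; exists a => //; apply: ballxx; rewrite divr_gt0.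
move=> u x y su [a Aa [ax1 ax2]] [b Ab [by1 by2]].
have := dot_le_dist a b su; have := le_trans (dist_le_diameter Aa Ab) Ad.
rewrite lee_fin => h1 h2.
have near c z : ball c.1 (e / 4) z.1 -> ball c.2 (e / 4) z.2 ->
    `|dot u z - dot u c| <= e / 2.
  rewrite /ball /= => z1 z2; have [u1 u2] := short_coord su.
  have -> : dot u z - dot u c = u.1 * (z.1 - c.1) + u.2 * (z.2 - c.2).
    by rewrite /dot; ring.
  apply: (le_trans (ler_normD _ _)); rewrite !normrM.
  rewrite distrC in z1; rewrite distrC in z2.
  have := ler_pM (normr_ge0 _) (normr_ge0 _) u1 (ltW z1).
  have := ler_pM (normr_ge0 _) (normr_ge0 _) u2 (ltW z2).
  by lra.
have := near _ _ ax1 ax2; have := near _ _ by1 by2.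
by rewrite !ler_norml => /andP[? ?] /andP[? ?]; lra.
Qed.

(** Evidence that a connected set K has length at least l, by calibration; a
    span between two points is the case u3 = 0. *)
Definition tripod K (l : R) := exists a b c u1 u2 u3,
  [/\ K a /\ K b, K c, short u1 /\ short u2, short u3 &
      u1 + u2 + u3 = 0 /\ l <= dot u1 a + dot u2 b + dot u3 c].

Lemma sum_half_pow (e : R) N :
  \sum_(i < N) e / 2 ^+ i.+1 = e - e / 2 ^+ N.
Proof.
elim: N => [|N IH]; first by rewrite big_ord0 expr0 divr1 subrr.
by rewrite big_ord_recr /= IH exprS; field; rewrite expf_neq0.
Qed.

(** The i-th set of the covering is enlarged to an open set at the price of
    e / 2 ^ (i + 1), so that the total widths grow by at most e; compactness
    then leaves finitely many of them. *)
Lemma finite_thickening K (F : nat -> set (R * R)) (dl e v : R) : compact K ->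
  0 < e -> K `<=` \bigcup_i F i -> (forall i, (diameter (F i) <= dl%:E)%E) ->
  (\sum_(0 <= i <oo) diameter (F i) <= v%:E)%E ->
  exists N (U : 'I_N -> set (R * R)) (w : 'I_N -> R),
    [/\ forall i, open (U i), K `<=` \bigcup_i U i,
        forall i u x y, short u -> U i x -> U i y -> dot u x - dot u y <= w i,
        forall i, 0 <= w i <= dl + e & \sum_i w i <= v + e].
Proof.
move=> cK e0 KF Fdl Fv.
have Ffin i : diameter (F i) \is a fin_num.
  rewrite ge0_fin_numE ?diameter_ge0 //; apply: (le_lt_trans (Fdl i)).
  exact: ltry.
pose ei i : R := e / 2 ^+ i.+1.
have ei0 i : 0 < ei i by rewrite divr_gt0 // exprn_gt0.
have Ed i : (diameter (F i) <= (fine (diameter (F i)))%:E)%E by rewrite fineK.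
have [U UP] := choice (fun i => thicken (ei0 i) (Ed i)).
have [N KN] : exists N, K `<=` [set x | exists2 i, (i < N)%N & U i x].
  have /compact_near_coveringP/(_ nat \oo
    (fun n x => exists2 i, (i < n)%N & U i x)) := cK.
  case=> [x Kx|N _ KN]; last by exists N; exact: (KN N (leqnn N)).
  have [i _ Fx] := KF x Kx; have [Uo FU _] := UP i.
  exists (U i, [set n | (i < n)%N]) => /=; last by move=> [y n] /= [Uy ni]; exists i.
  by split; [exact: open_nbhs_nbhs (conj Uo (FU _ Fx)) | exists i.+1].
exists N, (fun i => U i), (fun i => fine (diameter (F i)) + ei i); split.
- by move=> i; have [] := UP i.
- by move=> x /KN[i iN Ux]; exists (Ordinal iN).
- by move=> i; have [] := UP i.
- move=> i; rewrite addr_ge0 ?(ltW (ei0 _)) ?fine_ge0 ?diameter_ge0 //=.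
  apply: lerD; first by rewrite -lee_fin fineK.
  rewrite ler_pdivrMr ?exprn_gt0 // ler_peMr ?(ltW e0) //.
  by rewrite exprn_ege1 // ler1n.
rewrite big_split /= sum_half_pow; apply: lerD.
  rewrite -lee_fin; apply: le_trans Fv.
  apply: le_trans (nneseries_lim_ge N _); last by move=> *; exact: diameter_ge0.
  rewrite big_mkord -sumEFin; apply: lee_sum => i _.
  by rewrite fineK.
by rewrite gerBl divr_ge0 ?exprn_ge0 // ltW.
Qed.

End LowerBound.

(** * Length of disjoint connected sets *)

Section DisjointPieces.
Context {R : realType}.

Lemma uniformly_separated (J : finType) (K : J -> set (R * R)) :
  (forall j, compact (K j)) -> (forall i j, i != j -> K i `&` K j = set0) ->
  exists2 r : R, 0 < r & forall i j x y, i != j -> K i x -> K j y ->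
    r <= Num.max `|x.1 - y.1| `|x.2 - y.2|.
Proof.
move=> cK K0.
have sep (p : J * J) : exists r : R, 0 < r /\ forall x y, p.1 != p.2 ->
    K p.1 x -> K p.2 y -> r <= Num.max `|x.1 - y.1| `|x.2 - y.2|.
  have [ij|ij] := eqVneq p.1 p.2; first by exists 1; split.
  have [r r0 rP] := compact_separated (cK p.1) (cK p.2) (K0 _ _ ij).
  by exists r; split=> // x y _; exact: rP.
have [r rP] := choice sep.
exists (\big[Num.min/1]_p r p).
  rewrite ltNge; apply/negP => /bigmin_leP[|[p _]]; first by rewrite ler10.
  by rewrite leNgt (rP p).1.
move=> i j x y ij Kx Ky; apply: le_trans ((rP (i, j)).2 x y ij Kx Ky).
exact: bigmin_le.
Qed.

(** A covering finer than the distance between the pieces splits into disjoint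
    families, one for each piece, to which [tripod_bound] applies.  Each
    piece contributes an error 4 * dl, and the thickening adds dl once; hence the
    choice of dl. *)
Lemma hausdorff1_ge_tripods (J : finType) (K : J -> set (R * R)) (l : J -> R)
    (Gamma : set (R * R)) :
  (forall j, compact (K j)) -> (forall j, connected (K j)) ->
  (forall i j, i != j -> K i `&` K j = set0) -> (forall j, K j `<=` Gamma) ->
  (forall j, tripod (K j) (l j)) -> ((\sum_j l j)%:E <= hausdorff1 Gamma)%E.
Proof.
move=> cK connK K0 KG lK; apply/lee_subgt0Pr => e e0; rewrite -EFinB.
have [r r0 rP] := uniformly_separated cK K0.
pose n : R := #|J|%:R.
have n0 : 0 <= n by rewrite ler0n.
pose dl := Num.min (r / 4) (e / (4 * n + 1)).
have n1 : 0 < 4 * n + 1 by lra.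
have dl0 : 0 < dl by rewrite lt_min !divr_gt0.
have dlr : 2 * dl < r.
  have : dl <= r / 4 by rewrite ge_min lexx.
  by lra.
have dle : dl * (4 * n + 1) <= e.
  by rewrite -ler_pdivlMr // ge_min lexx orbT.
apply: (@le_trans _ _ (hausdorff1_pre dl Gamma)); last first.
  by apply: ereal_sup_ubound; exists dl.
apply: le_ereal_inf_tmp => _ [F [Fdl GF] <-].
have v0 : (0 <= \sum_(0 <= i <oo) diameter (F i))%E.
  by apply: nneseries_ge0 => *; exact: diameter_ge0.
case vE : (\sum_(0 <= i <oo) diameter (F i))%E v0 => [v| |] // _; last by rewrite leey.
rewrite lee_fin.
have Fv : (\sum_(0 <= i <oo) diameter (F i) <= v%:E)%E by rewrite vE.
have cU : compact (\bigcup_j K j).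
  have -> : \bigcup_j K j = \big[setU/set0]_(j in J) K j.
    by rewrite -bigcup_pred; apply/seteqP; split=> x [j _ Kx]; exists j.
  exact: bigsetU_compact.
have UF : \bigcup_j K j `<=` \bigcup_i F i by move=> x [j _ Kx]; exact/GF/KG/Kx.
have [N [U [w [Uo KU Uw w0 wv]]]] := finite_thickening cU dl0 UF Fdl Fv.
have wge0 i : 0 <= w i by have /andP[] := w0 i.
have wle i : w i <= 2 * dl by have /andP[_] := w0 i; lra.
have lj j : l j <= \sum_(i in touching U (K j)) w i + 2 * (2 * dl).
  have [a [b [c [u1 [u2 [u3 [[Ka Kb] Kc [s1 s2] s3 [u0 lj]]]]]]]] := lK j.
  apply: le_trans lj _.
  apply: (tripod_bound Uo wge0 Uw _ _ wle Ka Kb Kc s1 s2 s3 u0) => //.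
  by move=> x Kx; apply: KU; exists j.
have tdisj i j : i != j -> [disjoint touching U (K i) & touching U (K j)]%B.
  move=> ij; apply/pred0P => k /=; apply/negP => /andP[].
  move=> /touchingP[x Ux Kx] /touchingP[y Uy Ky].
  have := rP _ _ _ _ ij Kx Ky; apply/negP; rewrite -ltNge gt_max !ltr_norml.
  have c1 : short (1 : R, 0 : R) by rewrite /short /=; lra.
  have c2 : short (0 : R, 1 : R) by rewrite /short /=; lra.
  have := wle k; have := Uw _ _ _ _ c1 Ux Uy; have := Uw _ _ _ _ c1 Uy Ux.
  have := Uw _ _ _ _ c2 Ux Uy; have := Uw _ _ _ _ c2 Uy Ux.
  by rewrite /dot /= => *; apply/andP; split; apply/andP; split; lra.
have tot : \sum_j \sum_(i in touching U (K j)) w i <= \sum_i w i.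
  rewrite -(partition_disjoint_bigcup _ _ tdisj) [leRHS](bigID
    (fun i => i \in (\bigcup_j touching U (K j))%SET)) /= lerDl.
  by apply: sumr_ge0.
have : \sum_j l j <= \sum_j (\sum_(i in touching U (K j)) w i + 2 * (2 * dl)).
  by apply: ler_sum.
rewrite big_split /= sumr_const -mulr_natr -/n.
by move: dle tot wv; lra.
Qed.
End DisjointPieces.

(** * Length of a union of segments *)

Section UpperBound.
Context {R : realType}.
Implicit Types (a b x y : R * R) (A B : set (R * R)).

Definition seg a b : set (R * R) :=
  [set (a.1 + t * (b.1 - a.1), a.2 + t * (b.2 - a.2)) | t in `[0, 1]%classic].

Lemma seg_continuous a b :
  continuous (fun t : R => (a.1 + t * (b.1 - a.1), a.2 + t * (b.2 - a.2))).
Proof.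
have c (p q : R) : continuous (fun t : R => p + t * q).
  by move=> t; apply: cvgD; [exact: cvg_cst | apply: cvgM; [exact: cvg_id | exact: cvg_cst]].
move=> t; apply: (@cvg_pair _ _ _ _ (nbhs _) (nbhs _)); exact: c.
Qed.

Lemma seg_compact a b : compact (seg a b).
Proof.
apply: continuous_compact; last exact: segment_compact.
exact/continuous_subspaceT/seg_continuous.
Qed.

Lemma seg_connected a b : connected (seg a b).
Proof.
apply: connected_continuous_connected; first exact: segment_connected.
exact/continuous_subspaceT/seg_continuous.
Qed.

Lemma segl a b : seg a b a.
Proof.
exists 0; first by rewrite /= in_itv /= lexx ler01.
by rewrite !mul0r !addr0 -surjective_pairing.
Qed.

Lemma segr a b : seg a b b.
Proof.
exists 1; first by rewrite /= in_itv /= lexx ler01.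
by rewrite !mul1r !subrKC -surjective_pairing.
Qed.

Lemma diameter_le A (d : R) : 0 <= d ->
  (forall x y, A x -> A y -> euclid_dist x y <= d) -> (diameter A <= d%:E)%E.
Proof.
move=> d0 Ad; apply: ge_ereal_sup => _ [->|[x Ax [y Ay <-]]].
  by rewrite lee_fin.
by rewrite lee_fin; exact: Ad.
Qed.

Lemma diameter0 : diameter (set0 : set (R * R)) = 0%E.
Proof. by apply/eqP; rewrite eq_le diameter_ge0 andbT; exact: diameter_le. Qed.

(** Finite coverings by small sets, which unlike the Hausdorff premeasure are
    directly stable under concatenation. *)
Definition chopped (dl : R) A (l : R) := exists s : seq (set (R * R)),
  [/\ forall i, (diameter (nth set0 s i) <= dl%:E)%E,
      A `<=` \bigcup_i nth set0 s i &
      (\sum_(B <- s) diameter B <= l%:E)%E].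

Lemma hausdorff1_le A (l : R) : (forall dl, 0 < dl -> chopped dl A l) ->
  (hausdorff1 A <= l%:E)%E.
Proof.
move=> Al; apply: ge_ereal_sup => _ [dl /= dl0 <-].
have [s [sdl As sl]] := Al _ dl0.
apply: le_trans sl; apply: ereal_inf_lbound; exists (nth set0 s) => //.
rewrite (nneseries_split 0 (size s)) => [|*]; last exact: diameter_ge0.
rewrite add0n eseries0 ?adde0 => [|i si _]; last first.
  by rewrite nth_default // diameter0.
by rewrite -(big_nth set0 xpredT).
Qed.

Lemma chopped_cat (dl : R) A B l k : 0 < dl ->
  chopped dl A l -> chopped dl B k -> chopped dl (A `|` B) (l + k).
Proof.
move=> dl0 [s [sdl As sl]] [t [tdl Bt tk]]; exists (s ++ t); split.
- by move=> i; rewrite nth_cat; case: ifP.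
- move=> x [/As|/Bt] [i _ ix].
    exists i => //; rewrite nth_cat; case: ltnP => // si.
    by move: ix; rewrite nth_default.
  exists (size s + i)%N => //; rewrite nth_cat ltnNge leq_addr /=.
  by rewrite addKn.
- by rewrite big_cat /= EFinD; exact: leeD.
Qed.

Lemma chopped_segment (dl : R) a b : 0 < dl ->
  chopped dl (seg a b) (euclid_dist a b).
Proof.
move=> dl0; set l := euclid_dist a b.
have l0 : 0 <= l by exact: sqrtr_ge0.
pose n := (Num.bound (l / dl)).+1.
have n0 : 0 < n%:R :> R by rewrite ltr0n.
have ln : l / n%:R <= dl.
  rewrite ler_pdivrMr // mulrC -ler_pdivrMr //.
  apply: (le_trans (ltW (archi_boundP _))); first by rewrite divr_ge0 // ltW.
  by rewrite ler_nat.
pose pt t : R * R := (a.1 + t * (b.1 - a.1), a.2 + t * (b.2 - a.2)).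
pose piece k := [set pt t | t in `[k%:R / n%:R, k.+1%:R / n%:R]%classic].
have dpt t t' : euclid_dist (pt t) (pt t') = `|t - t'| * l.
  rewrite /euclid_dist /=.
  have -> : (a.1 + t * (b.1 - a.1) - (a.1 + t' * (b.1 - a.1))) ^+ 2 +
      (a.2 + t * (b.2 - a.2) - (a.2 + t' * (b.2 - a.2))) ^+ 2 =
      (t - t') ^+ 2 * ((a.1 - b.1) ^+ 2 + (a.2 - b.2) ^+ 2) by ring.
  by rewrite sqrtrM ?sqr_ge0 // sqrtr_sqr.
have dpiece k : (diameter (piece k) <= (l / n%:R)%:E)%E.
  apply: diameter_le; first by rewrite divr_ge0 // ltW.
  move=> _ _ [t + <-] [t' + <-]; rewrite dpt /= !in_itv /= => /andP[t1 t2] /andP[t3 t4].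
  rewrite mulrC ler_wpM2l // ler_norml.
  move: t2 t4; rewrite -addn1 natrD mulrDl mul1r => t2 t4.
  by apply/andP; split; lra.
exists (mkseq piece n); split.
- move=> i; have [ni|ni] := ltnP i n.
    by rewrite nth_mkseq //; apply: (le_trans (dpiece i)); rewrite lee_fin.
  by rewrite nth_default ?size_mkseq // diameter0 lee_fin ltW.
- move=> _ [t + <-]; rewrite /= in_itv /= => /andP[t0 t1].
  have [t1' | t1'] := eqVneq t 1.
    (* The end point t = 1 belongs to the last of the n pieces. *)
    exists n.-1 => //; rewrite nth_mkseq //; exists t => //=.
    rewrite in_itv /= t1' mulfV ?gt_eqF // lexx andbT ler_pdivrMr // mul1r.
    by rewrite ler_nat.
  have tn0 : 0 <= t * n%:R by rewrite mulr_ge0 // ltW.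
  have /andP[k1 k2] := truncn_itv tn0.
  exists (Num.truncn (t * n%:R)) => //; rewrite nth_mkseq; last first.
    rewrite -(ltr_nat R); apply: (le_lt_trans k1).
    by rewrite gtr_pMl // lt_neqAle t1' t1.
  exists t => //=; rewrite in_itv /= ler_pdivrMr // k1 /= ler_pdivlMr //.
  exact: ltW.
- rewrite big_map; apply: (@le_trans _ _ (\sum_(0 <= k < n) (l / n%:R)%:E)%E).
    by rewrite /index_iota subn0; apply: lee_sum.
  rewrite sumEFin lee_fin sumr_const_nat subn0 -[_ *+ n]mulr_natr divfK //.
  by rewrite gt_eqF.
Qed.

Lemma hausdorff1_le_segments A (s : seq ((R * R) * (R * R))) :
  A `<=` \bigcup_(p in [set` s]) seg p.1 p.2 ->
  (hausdorff1 A <= (\sum_(p <- s) euclid_dist p.1 p.2)%:E)%E.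
Proof.
move=> As; apply: hausdorff1_le => dl dl0.
elim: s A As => [|p s IH] A As.
  exists [::]; split; rewrite ?big_nil //.
    by move=> i; rewrite nth_nil diameter0 lee_fin ltW.
  by move=> x /As[].
rewrite big_cons.
have [t [h1 h2 h3]] := chopped_cat dl0 (chopped_segment p.1 p.2 dl0)
  (IH _ (fun x h => h)).
exists t; split => // x /As[q /=]; rewrite inE => /predU1P[-> qx|qs qx].
  by apply: h2; left.
by apply: h2; right; exists q.
Qed.

End UpperBound.

(** * The nine points and the tree *)

Lemma pair_eq (S T : Type) (a a' : S) (b b' : T) :
  a = a' -> b = b' -> (a, b) = (a', b').
Proof. by move=> -> ->. Qed.

Section Configuration.
Context {R : realType}.
Variables (c : R * R) (s : R).
Hypothesis s_gt0 : 0 < s.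

(** The origin, and for each side (true is the right one) and each half (true is
    the upper one), the outer (true) and inner points of the tip. *)
Definition label : Type := option (bool * bool * bool).

Definition sg (b : bool) : R := if b then 1 else - 1.

(** The inner point divides the limb from (4, 1) to (13/4, 0) in the ratio
    1 : 99, whence 4 - 3/400 and 99/100. *)
Definition site (i : label) : R * R :=
  if i is Some (r, t, o) then
    (c.1 + s * (sg r * (if o then 4 else 4 - 3 / 400)),
     c.2 + s * (sg t * (if o then 1 else 99 / 100)))
  else c.

Definition joint (r : bool) : R * R := (c.1 + s * (sg r * (13 / 4)), c.2).

Definition limb (r t : bool) := seg (site (Some (r, t, true))) (joint r).

Definition trunk := seg (joint false) (joint true).

(** The trunk is repeated in each piece so that the pieces are connected and
    share a point. *)
Definition tree : set (R * R) :=
  \bigcup_(p : bool * bool) (trunk `|` limb p.1 p.2).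

Lemma site_inj : injective site.
Proof.
have s0 : s != 0 by rewrite gt_eqF.
move=> [[[r t] o]|] [[[r' t'] o']|] //=.
- case=> /addrI/(mulfI s0) + /addrI/(mulfI s0).
  by case: r r' t t' o o' => [] [] [] [] [] [] /= h1 h2 //; exfalso; move: h1 h2; lra.
- case: c => c1 c2 [] /= /eqP + _; rewrite -subr_eq0 addrAC subrr add0r.
  rewrite mulf_eq0 (negbTE s0) /= => /eqP e; exfalso; move: e.
  by case: r; case: o => /=; lra.
- case: c => c1 c2 [] /= /esym/eqP + _; rewrite -subr_eq0 addrAC subrr add0r.
  rewrite mulf_eq0 (negbTE s0) /= => /eqP e; exfalso; move: e.
  by case: r'; case: o' => /=; lra.
Qed.

Lemma site_tree i : tree (site i).
Proof.
case: i => [[[r t] []]|].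
- by exists (r, t) => //; right; exact: segl.
- exists (r, t) => //; right; exists (1 / 100).
    by rewrite /= in_itv /=; apply/andP; split; lra.
  by apply: pair_eq; case: r; case: t => /=; field.
- exists (true, true) => //; left; exists (1 / 2).
    by rewrite /= in_itv /=; apply/andP; split; lra.
  by rewrite [RHS]surjective_pairing; apply: pair_eq => /=; field.
Qed.

Lemma limb_trunk r t : (limb r t `&` trunk) (joint r).
Proof. by split; [exact: segr | case: r; [exact: segr | exact: segl]]. Qed.

Lemma tree_connected : connected tree.
Proof.
apply: bigcup_connected; first by exists (joint true) => p _; left; exact: segr.
move=> [r t] _; apply: connectedU; try exact: seg_connected.
by exists (joint r); rewrite setIC; exact: limb_trunk.
Qed.

Lemma tree_compact : compact tree.
Proof.
have -> : tree = \big[setU/set0]_(p in {: bool * bool}) (trunk `|` limb p.1 p.2).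
  by rewrite -bigcup_pred; apply/seteqP; split=> x [p _ h]; exists p.
by apply: bigsetU_compact => p _; apply: compactU; exact: seg_compact.
Qed.

Lemma limb_length r t : euclid_dist (site (Some (r, t, true))) (joint r) = s * (5 / 4).
Proof.
rewrite /euclid_dist -[RHS]ger0_norm ?mulr_ge0 ?(ltW s_gt0) //.
rewrite -sqrtr_sqr; congr Num.sqrt.
by case: r; case: t => /=; field.
Qed.

Lemma trunk_length : euclid_dist (joint false) (joint true) = s * (13 / 2).
Proof.
rewrite /euclid_dist -[RHS]ger0_norm ?mulr_ge0 ?(ltW s_gt0) //.
by rewrite -sqrtr_sqr; congr Num.sqrt; rewrite /=; field.
Qed.

Lemma tree_length : (hausdorff1 tree <= (s * (23 / 2))%:E)%E.
Proof.
pose p r t := (site (Some (r, t, true)), joint r).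
have := @hausdorff1_le_segments _ tree
  [:: (joint false, joint true); p true true; p true false; p false true; p false false].
have limbE r t : euclid_dist (p r t).1 (p r t).2 = s * (5 / 4).
  exact: limb_length.
rewrite !big_cons big_nil !limbE trunk_length.
rewrite (_ : _ + _ = s * (23 / 2)); last by field.
apply; move=> x [[r t] _ [tx|lx]].
  by exists (joint false, joint true) => //=; rewrite mem_head.
exists (p r t) => //=.
by case: r t {lx} => [] []; rewrite !in_cons eqxx !orbT.
Qed.

Lemma tripod_span (K : set (R * R)) a b u l : short u -> K a -> K b ->
  l <= dot u b - dot u a -> tripod K l.
Proof.
move=> us Ka Kb lab; exists b, a, a, u, (- u), 0; split=> //.
- by split=> //; exact: short_opp.
- by rewrite /short /= expr0n /= addr0.
- rewrite subrr addr0; split=> //.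
  by rewrite dotNl (_ : dot 0 a = 0) ?addr0 // /dot /= !mul0r addr0.
Qed.

Lemma tripod_across K t o t' o' : K (site (Some (false, t, o))) ->
  K (site (Some (true, t', o'))) -> tripod K (s * (8 - 3 / 200)).
Proof.
move=> Ka Kb; apply: (tripod_span (u := (1, 0)) _ Ka Kb).
  by rewrite /short /=; lra.
by rewrite /dot /=; case: o {Ka}; case: o' {Kb}; move: s_gt0; lra.
Qed.

Lemma tripod_arm K r t o : K (site None) -> K (site (Some (r, t, o))) ->
  tripod K (s * (4 - 3 / 400)).
Proof.
move=> Ka Kb; apply: (tripod_span (u := (sg r, 0)) _ Ka Kb).
  by rewrite /short /=; case: r {Kb} => /=; lra.
by rewrite /dot /=; case: r {Kb}; case: o => /=; move: s_gt0; lra.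
Qed.

Lemma tripod_vertical K r o r' o' : K (site (Some (r, false, o))) ->
  K (site (Some (r', true, o'))) -> tripod K (s * (99 / 50)).
Proof.
move=> Ka Kb; apply: (tripod_span (u := (0, 1)) _ Ka Kb).
  by rewrite /short /=; lra.
by rewrite /dot /=; case: o {Ka}; case: o' {Kb}; move: s_gt0; lra.
Qed.

(** The best vectors are (1/2, sqrt 3 / 2), (1/2, - sqrt 3 / 2) and (-1, 0), those
    of the Steiner point; the rational value 17/20 < sqrt 3 / 2 is close enough
    to beat the fork of the tree. *)
Lemma tripod_fork K r t o : K (site (Some (r, true, true))) ->
  K (site (Some (r, false, true))) -> K (site (Some (~~ r, t, o))) ->
  tripod K (s * (97 / 10 - 3 / 400)).
Proof.
move=> Ka Kb Kc; exists (site (Some (r, true, true))),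
  (site (Some (r, false, true))), (site (Some (~~ r, t, o))),
  (sg r / 2, 17 / 20), (sg r / 2, - (17 / 20)), (- sg r, 0); split=> //.
- by split; rewrite /short /=; case: r {Ka Kb Kc} => /=; lra.
- by rewrite /short /=; case: r {Ka Kb Kc} => /=; lra.
- split; first by apply: pair_eq; case: r {Ka Kb Kc} => /=; field.
  by rewrite /dot /=; case: r {Ka Kb Kc}; case: o => /=; move: s_gt0; lra.
Qed.

End Configuration.

(** * Components of a disconnected competitor *)

Section Components.
Context {R : realType}.
Variables (c : R * R) (s : R).
Hypothesis s_gt0 : 0 < s.
Variable Gamma : set (R * R).
Hypothesis Gamma_compact : compact Gamma.
Hypothesis Gamma_site : range (site c s) `<=` Gamma.
Hypothesis Gamma_card : forall x, Gamma x -> exists2 k : nat, (0 < k)%N &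
  ((connected_component Gamma x `&` range (site c s)) #= `I_(3 * k))%card.

Definition comp (i : label) : set (R * R) := connected_component Gamma (site c s i).

Definition mates (i : label) : {set label} := [set k | `[< comp i (site c s k) >]].

Lemma matesP i k : reflect (comp i (site c s k)) (k \in mates i).
Proof. by rewrite finset.in_set; exact: asboolP. Qed.

Lemma comp_site i : comp i (site c s i).
Proof. by apply: connected_component_refl; apply: Gamma_site; exists i. Qed.

Lemma mates_refl i : i \in mates i.
Proof. by apply/matesP; exact: comp_site. Qed.

Lemma comp_eq i k : k \in mates i -> comp i = comp k.
Proof. by move=> /matesP /same_connected_component. Qed.

Lemma mates_eq i k : k \in mates i -> mates i = mates k.
Proof. by move=> /comp_eq ik; apply/setP => j; rewrite !finset.in_set ik. Qed.

Lemma comp_disjoint i k : k \notin mates i -> comp i `&` comp k = set0.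
Proof.
move=> ik; apply/seteqP; split=> // x [ix kx]; exfalso.
move/negP: ik; apply; apply/matesP.
rewrite /comp (same_connected_component ix) -(same_connected_component kx).
exact: comp_site.
Qed.

Lemma card_mates i : exists2 k : nat, (0 < k)%N & #|mates i| = (3 * k)%N.
Proof.
have [k k0 kP] := Gamma_card (Gamma_site (imageT _ i)); exists k => //.
apply/card_eq_II; apply: card_eq_trans kP.
have /card_eq_trans : (`I_#|mates i| #= [set: 'I_#|mates i|])%card := card_II.
apply; apply/card_set_bijP.
exists (fun j : 'I_#|mates i| => site c s (enum_val j)); split.
- by move=> j _; split; [apply/matesP; exact: enum_valP | exists (enum_val j)].
- by move=> j j' _ _ /(site_inj s_gt0)/enum_val_inj.
- move=> y [yc [k' _ yE]]; subst y; move/matesP: yc => k'i; exists (enum_rank_in k'i k') => //.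
  by rewrite enum_rankK_in.
Qed.

(** Stated for lists, because two components suffice in some cases and three are
    needed in others. *)
Lemma comps_length (t : seq (label * R)) :
  pairwise (fun p q => q.1 \notin mates p.1) t ->
  (forall j, (j < size t)%N ->
     tripod (comp (nth (None, 0) t j).1) (nth (None, 0) t j).2) ->
  ((\sum_(p <- t) p.2)%:E <= hausdorff1 Gamma)%E.
Proof.
move=> /(pairwiseP (None, 0)) tP tl; rewrite (big_nth (None, 0)) big_mkord.
apply: (hausdorff1_ge_tripods (K := fun j : 'I_(size t) => comp (nth (None, 0) t j).1)).
- move=> j; apply: (subclosed_compact _ Gamma_compact).
    by apply: component_closed; apply: compact_closed => //; exact: norm_hausdorff.
  exact: connected_component_sub.
- by move=> j; exact: component_connected.
- move=> i j; rewrite neq_ltn => /orP[ij|ji].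
    by apply: comp_disjoint; exact: (tP i j (ltn_ord i) (ltn_ord j) ij).
  by rewrite setIC; apply: comp_disjoint; exact: (tP j i (ltn_ord j) (ltn_ord i) ji).
- by move=> j; exact: connected_component_sub.
- by move=> j; exact: tl.
Qed.

Definition side (r : bool) : seq label :=
  [seq Some (r, t, o) | t <- [:: true; false], o <- [:: true; false]].

Lemma mem_side r r' t o : (Some (r', t, o) \in side r) = (r' == r).
Proof. by case: r r' t o => [] [] [] []. Qed.

Lemma None_side r : None \notin side r.
Proof. by case: r. Qed.

Lemma disconnected_witness : ~ connected Gamma -> exists k, k \notin mates None.
Proof.
move=> nconn; apply: contrapT => noK; apply: nconn.
suff -> : Gamma = comp None by exact: component_connected.
apply/seteqP; split; last exact: connected_component_sub.
move=> x Gx; have [k k0 kP] := Gamma_card Gx.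
have [y [xy [i _ iE]]] : connected_component Gamma x `&` range (site c s) !=set0.
  apply/set0P; apply/negP => /eqP e0; move: kP; rewrite e0 card_eq_sym.
  rewrite card_eq0 => /eqP I0; have : `I_(3 * k) 0%N by rewrite /= muln_gt0 k0.
  by rewrite I0.
subst y; have /matesP : i \in mates None by apply: contrapT => /negP ?; apply: noK; exists i.
move=> /same_connected_component; rewrite /comp => ->.
by rewrite -(same_connected_component xy); exact: connected_component_refl.
Qed.

(** The component of the origin contains another point, so it has length at
    least 4 - 3/400 besides the length 8 - 3/200 of the crossing component. *)
Lemma crossing_length k t o t' o' : k \notin mates None ->
  Some (false, t, o) \in mates k -> Some (true, t', o') \in mates k ->
  ((s * (58 / 5))%:E <= hausdorff1 Gamma)%E.
Proof.
move=> kN /matesP k1 /matesP k2.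
have [r [t1 [p1 rN]]] : exists r t1 p1, Some (r, t1, p1) \in mates None.
  have [i] : exists i, i \in mates None :\ None.
    apply/finset.set0Pn; rewrite -card_gt0.
    have [q q0] := card_mates None; rewrite (cardsD1 None) mates_refl add1n.
    by move: q0; case: #|_| => [|n]; lia.
  case: i => [[[r t1] p1]|]; rewrite finset.in_setD1 // => iN.
  by exists r, t1, p1.
have := @comps_length [:: (None, s * (4 - 3 / 400)); (k, s * (8 - 3 / 200))].
rewrite /= kN /= big_cons big_seq1 /= => /(_ isT) H.
apply: le_trans (H _); first by rewrite lee_fin; move: s_gt0; lra.
move=> [|[|j]] //= _; last exact: (tripod_across _ k1 k2).
by apply: (tripod_arm s_gt0 (comp_site None)); apply/matesP; exact: rN.
Qed.

Hypothesis Gamma_short : (hausdorff1 Gamma < (s * (58 / 5))%:E)%E.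

Lemma mates_side k r : k \notin mates None -> k \in side r ->
  {subset mates k <= side r}.
Proof.
move=> kN; case: k kN => [[[r' t] o]|]; last by rewrite (negbTE (None_side r)).
rewrite mem_side => kN /eqP rE; subst r' => i ik.
case: i ik => [[[r' t'] o']|] ik; last first.
  by move: kN; rewrite -(mates_eq ik) mates_refl.
rewrite mem_side; apply/negPn/negP => rr.
suff : ((s * (58 / 5))%:E <= hausdorff1 Gamma)%E by rewrite leNgt Gamma_short.
have kk := mates_refl (Some (r, t, o)).
by case: r r' kN ik kk rr => [] [] // kN ik kk _;
  [exact: crossing_length ik kk | exact: crossing_length kk ik].
Qed.

Lemma card_le_size (A : {set label}) (t : seq label) :
  {subset A <= t} -> (#|A| <= size t)%N.
Proof.
by move=> At; apply: (leq_trans _ (card_size t)); apply/subset_leq_card/fintype.subsetP.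
Qed.

(** The number of points in such a component is a multiple of 3 and at most 4,
    so it is 3: more than the 2 points of one tip, and leaving exactly one of
    the 4 points of the side.  That point would need two companions on the same
    side if it were not in the component of the origin. *)
Lemma local_mates k r : k \notin mates None -> k \in side r ->
  tripod (comp k) (s * (99 / 50)) /\
  exists t o, Some (r, t, o) \in mates None.
Proof.
move=> kN kr; have sub := mates_side kN kr.
have card3 : #|mates k| = 3.
  by have := card_le_size sub; have [q q0 ->] := card_mates k; rewrite /=; lia.
have half t : exists o, Some (r, t, o) \in mates k.
  apply: contrapT => no.
  have : (#|mates k| <= size [seq Some (r, ~~ t, o) | o <- [:: true; false]])%N.
    apply: card_le_size => i ik; have := sub _ ik.
    case: i ik => [[[r' t'] o]|] ik; last by rewrite (negbTE (None_side r)).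
    rewrite mem_side => /eqP rE; subst r'.
    have -> : t' = ~~ t.
      have [tt|] := eqVneq t' t; first by exfalso; apply: no; exists o; rewrite -tt.
      by case: t' {ik} t {no} => [] [].
    by case: o {ik}; rewrite /= !in_cons eqxx ?orbT.
  by rewrite card3 size_map.
split.
  have [p1 /matesP h1] := half false; have [p2 /matesP h2] := half true.
  exact: (tripod_vertical s_gt0 h1 h2).
have [i ir ik] : exists2 i, i \in side r & i \notin mates k.
  apply: contrapT => no.
  have : (size (side r) <= #|mates k|)%N.
    have /card_uniqP <- : uniq (side r) by case: (r).
    apply/subset_leq_card/fintype.subsetP => i ir; apply/negPn/negP => ik.
    by apply: no; exists i.
  by rewrite card3.
have iN : i \in mates None.
  apply/negPn/negP => iN.
  have : (#|mates k :|: mates i| <= size (side r))%N.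
    by apply: card_le_size => j; rewrite finset.inE => /orP[/sub|/(mates_side iN ir)].
  rewrite cardsU disjoint_setI0 ?cards0.
    by have [q q0 ->] := card_mates i; rewrite card3 /=; lia.
  apply/pred0P => j /=; apply/negP => /andP[jk ji]; move/negP: ik; apply.
  by rewrite (mates_eq jk) -(mates_eq ji) mates_refl.
case: i ir ik iN => [[[r' t] o]|]; last by rewrite (negbTE (None_side r)).
by rewrite mem_side => /eqP -> _ ?; exists t, o.
Qed.

(** Some side has a local component.  On the other side, either both outer tips
    belong to the component of the origin, which satisfies the fork bound, or
    there is a second local component and the component of the origin still
    reaches both sides. *)
Lemma short_connected : connected Gamma.
Proof.
apply: contrapT => /disconnected_witness [k kN].
case: k kN => [[[r t] o]|]; last by rewrite mates_refl.
set k := Some _ => kN.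
have kr : k \in side r by rewrite mem_side.
have [kl [t1 [p1 /matesP rN]]] := local_mates kN kr.
suff : ((s * (58 / 5))%:E <= hausdorff1 Gamma)%E by rewrite leNgt Gamma_short.
have [all|] := pselect (forall t', Some (~~ r, t', true) \in mates None).
  have /matesP h1 := all true; have /matesP h2 := all false.
  have := @comps_length [:: (None, s * (97 / 10 - 3 / 400)); (k, s * (99 / 50))].
  rewrite /= kN /= big_cons big_seq1 /= => /(_ isT) H.
  apply: le_trans (H _); first by rewrite lee_fin; move: s_gt0; lra.
  move=> [|[|j]] //= _; apply: (tripod_fork s_gt0 h1 h2 (t := t1) (o := p1)).
  by rewrite negbK.
move=> /existsNP[t' /negP]; set k' := Some _ => kN'.
have kr' : k' \in side (~~ r) by rewrite mem_side.
have [kl' [t2 [p2 /matesP rN']]] := local_mates kN' kr'.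
have kk' : k' \notin mates k.
  by apply/negP => /(mates_side kN kr); rewrite mem_side; case: (r).
have := @comps_length [:: (None, s * (8 - 3 / 200)); (k, s * (99 / 50)); (k', s * (99 / 50))].
rewrite /= kN kN' kk' /= !big_cons big_nil /= => /(_ isT) H.
apply: le_trans (H _); first by rewrite lee_fin; move: s_gt0; lra.
move=> [|[|[|j]]] //= _.
by case: (r) rN rN' => rN rN'; [exact: tripod_across rN' rN | exact: tripod_across rN rN'].
Qed.

End Components.

(** * The measure and its support *)

Section Measure.
Context {R : realType}.

Lemma two_pi_ge0 : 0 <= 2 * pi :> R.
Proof. by rewrite mulr_ge0 // pi_ge0. Qed.

(** [inord] only extends the family of points to a sequence of which [msum] takes
    the first n + 1 terms. *)
Definition vortex_measure n (x : 'I_n.+1 -> R * R) : {measure set (R * R) -> \bar R} :=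
  mscale (NngNum two_pi_ge0) (msum (fun k => \d_(x (inord k))) n.+1).

Lemma vortex_measureE n (x : 'I_n.+1 -> R * R) A :
  vortex_measure x A = ((2 * pi)%:E * \sum_(k < n.+1) \d_(x k) A)%E.
Proof.
rewrite /vortex_measure /= /mscale /= /msum; congr (_ * _)%E.
by apply: eq_bigr => k _; rewrite inord_val.
Qed.

Lemma spt_vortex_measure n (x : 'I_n.+1 -> R * R) :
  spt (vortex_measure x) = range x.
Proof.
apply/seteqP; split=> y; last first.
  move=> [k _ <-] U _ Uk; rewrite vortex_measureE.
  rewrite mule_gt0 ?lte_fin ?mulr_gt0 ?pi_gt0 // (bigD1 k) //=.
  rewrite diracE mem_set //; apply: lt_le_trans (leeDl _ _); first exact: lte01.
  by apply: sume_ge0 => i _; rewrite diracE lee_fin ler0n.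
move=> yU; apply: contrapT => yx.
have : (0 < vortex_measure x (~` range x))%E.
  apply: yU => //; apply: closed_openC.
  apply: compact_closed; first exact: norm_hausdorff.
  by apply: finite_compact; apply: finite_image; exact: finite_finset.
rewrite vortex_measureE big1 ?mule0 ?ltxx // => k _.
rewrite diracE memNset //; apply; by exists k.
Qed.

End Measure.

Section Realisation.
Context {R : realType}.

Lemma card_label : 9 = #|{: label}|.
Proof. by rewrite card_option !card_prod !card_bool. Qed.

Definition vortices (c : R * R) (s : R) (k : 'I_9) : R * R :=
  site c s (enum_val (cast_ord card_label k)).

Lemma vortices_inj c s : 0 < s -> injective (vortices c s).
Proof. by move=> s0 k k' /(site_inj s0)/enum_val_inj/cast_ord_inj. Qed.

Lemma range_vortices c s : range (vortices c s) = range (site c s).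
Proof.
apply/seteqP; split=> _ [k _ <-]; first by exists (enum_val (cast_ord card_label k)).
exists (cast_ord (esym card_label) (enum_rank k)) => //.
by rewrite /vortices cast_ordKV enum_rankK.
Qed.

Lemma site_near (Omega : set (R * R)) c : open Omega -> Omega c ->
  exists2 s : R, 0 < s & forall i, Omega (site c s i).
Proof.
move=> Oo Oc; have /nbhs_ballP[e /= e0 eO] := open_nbhs_nbhs (conj Oo Oc).
exists (e / 5); first by rewrite divr_gt0.
move=> i; apply: eO; case: i => [[[r t] o]|] /=; last exact: ballxx.
split; rewrite /ball /= ltr_norml; apply/andP;
  by case: r; case: t; case: o; rewrite /sg; split; lra.
Qed.

Lemma tree_admissible (c : R * R) s (mu : {measure set (R * R) -> \bar R}) :
  0 < s -> spt mu = range (site c s) -> admissible 3 mu (tree c s).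
Proof.
move=> s0 muE; split; first exact: tree_compact.
  by rewrite muE => _ [i _ <-]; exact: site_tree.
move=> x Tx; exists 3; rewrite // connected_component_id //; last exact: tree_connected.
rewrite muE setIidr; last by move=> _ [i _ <-]; exact: site_tree.
rewrite card_eq_sym -range_vortices; apply: card_eq_trans (@card_II 9) _.
apply/card_set_bijP; exists (vortices c s); split.
- by move=> k _; exists k.
- by move=> k k' _ _ /(vortices_inj s0).
- by [].
Qed.

End Realisation.

Unset Implicit Arguments.

Theorem proposition4p10 (R : realType) (m d : nat) (Omega : set (R * R))
    (Omega_neq0 : Omega !=set0) (Omega_open : open Omega)
    (Omega_bounded : bounded_set Omega) (Omega_convex : convex_set Omega)
    (Omega_smooth : smooth_boundary Omega) (m3 : m = 3%N) (d3 : d = 3%N) :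
  exists2 mu : {measure set (R * R) -> \bar R},
    vortex_measures m d Omega mu &
    forall Gamma : set (R * R), Lambda_minimizer m mu Gamma -> connected Gamma.
Proof.
subst m d; have [c Oc] := Omega_neq0.
have [s s0 sO] := site_near Omega_open Oc.
have muE := spt_vortex_measure (vortices c s); rewrite range_vortices in muE.
exists (vortex_measure (vortices c s)).
  exists (vortices c s); split; first exact: vortices_inj.
    by move=> k; exact: sO.
  by move=> A _; exact: vortex_measureE.
move=> Gamma [[cG sG kG] minG].
apply: (@short_connected _ c s s0 Gamma cG); rewrite -?muE //.
apply: (le_lt_trans (minG _ (tree_admissible s0 muE))).
apply: (le_lt_trans (tree_length c s0)); rewrite lte_fin.
by move: s0; lra.
Qed.
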